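(* Let $A\in\mathbb{C}^{n\times n}$ and $D\in\mathbb{C}^{m\times m}$ be Hermitian matrices. Let $\lambda_1\geq\ldots\geq\lambda_k>0\geq\lambda_{k+1}\geq\ldots\geq\lambda_n$ be the eigenvalues of $A$ and let $\mu_1\leq\ldots\leq\mu_r\leq 0<\mu_{r+1}\leq\ldots\leq\mu_m$ be the eigenvalues of $D$ (counted with multiplicities), and let $p=\dim(\ker D)$. Let $\kappa>0$ and assume that $$r\leq k\quad\text{and}\quad \kappa^2\lambda_i+\mu_i>0\ \text{ for all } i=1,\ldots,r-p.$$ For $i=1,\ldots,r-p$ choose $0<\varepsilon_i<\kappa^2$ such that $\varepsilon_i\lambda_i+\mu_i>0$, and for $j=r-p+1,\ldots,r$ let $0\leq\varepsilon_j<\kappa^2$ be arbitrary. Let $U\in\mathbb{C}^{n\times n}$ and $V\in\mathbb{C}^{m\times m}$ be unitary matrices with $A=U\,\mathrm{diag}(\lambda_1,\ldots,\lambda_n)\,U^*$ and $D=V\,\mathrm{diag}(\mu_1,\ldots,\mu_m)\,V^*$, let $E\in\mathbb{C}^{n\times m}$ be the matrix whose $(i,i)$ entry is $\sqrt{\varepsilon_i}$ for $i=1,\ldots,r$ and all of whose other entries are zero, and let $K:=UEV^*\in\mathbb{C}^{n\times m}$. Set $$\alpha_i:=\frac{(\lambda_i-\mu_i)^2}{4\lambda_i^2},\quad i=1,\ldots,r.$$ Then $\|K\|<\kappa$ and the spectrum of the block matrix $$S=\begin{bmatrix}A&-AK\\ K^*A&D\end{bmatrix}\in\mathbb{C}^{(n+m)\times(n+m)}$$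 consists of the real numbers $\lambda_{r+1},\ldots,\lambda_n$, $\mu_{r+1},\ldots,\mu_m$, and $$\eta_i^\pm=\frac{\lambda_i+\mu_i}{2}\pm\lambda_i\sqrt{\alpha_i-\varepsilon_i},\quad i=1,\ldots,r.$$ Moreover, for $i=1,\ldots,r$, we have: a) if $0<\varepsilon_i<\frac{-\mu_i}{\lambda_i}$, then $\lambda_i>\eta_i^+>0>\eta_i^->\mu_i$; b) if $\frac{-\mu_i}{\lambda_i}\leq\varepsilon_i<\alpha_i$, then $\max\{\lambda_i+\mu_i,0\}\geq\eta_i^+>\eta_i^-\geq\min\{\lambda_i+\mu_i,0\}$; c) if $\alpha_i<\varepsilon_i<\kappa^2$, then $\eta_i^+=\overline{\eta_i^-}\in\mathbb{C}\setminus\mathbb{R}$; d) if $\varepsilon_i=\alpha_i$, then $\eta_i^+=\eta_i^-=\frac12(\lambda_i+\mu_i)$ and there exists a Jordan chain of $S$ of length $2$ corresponding to this eigenvalue; e) if $i>r-p$ and $\varepsilon_i=0$, then $\eta_i^+=\lambda_i>0$ and $\eta_i^-=\mu_i=0$. Additionally, if $\varepsilon_i\neq\alpha_i$ for all $i=1,\ldots,r$, then $S$ is diagonalizable.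
   Context: $\|K\|$ denotes the spectral norm (largest singular value) of $K$. The integer $k$ is the number of positive eigenvalues of $A$ and $r$ is the number of non-positive eigenvalues of $D$, counted with multiplicities, so $r-p$ is the number of negative eigenvalues of $D$ and $\mu_{r-p+1}=\ldots=\mu_r=0$; note $\lambda_i>0$ for $i\leq r$. For $\alpha_i-\varepsilon_i<0$, the square root $\sqrt{\alpha_i-\varepsilon_i}$ means $\mathrm{i}\sqrt{\varepsilon_i-\alpha_i}$, where $\mathrm{i}$ is the imaginary unit. A Jordan chain of length $2$ of $S$ for the eigenvalue $\eta$ is a pair of vectors $v_1\neq 0$, $v_2$ with $(S-\eta I)v_1=0$ and $(S-\eta I)v_2=v_1$. *)

(* Defs.v *)
From mathcomp Require Import all_boot all_order all_algebra.
From mathcomp Require Import reals.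
From mathcomp Require Import complex.

Set Implicit Arguments.
Unset Strict Implicit.
Unset Printing Implicit Defensive.

Import Order.TTheory GRing.Theory Num.Theory.
(* The complex numbers are R[i] for R : realType, with x%:C the embedding of
   the reals.  The order of R[i] is the partial one: a comparison z < w entails
   that w - z is real, so that comparing with a real number asserts realness. *)
Local Open Scope complex_scope.
Local Open Scope ring_scope.
Local Open Scope sesquilinear_scope.

(* K^* K is Hermitian, hence spectral_diag lists its (nonnegative real)
   eigenvalues with multiplicities; taking the real part loses nothing. *)
Definition singular_value (R : realType) (n m : nat) (K : 'M[R[i]]_(n, m))
    (j : 'I_m) : R :=
  Num.sqrt (complex.Re (spectral_diag (K ^t* *m K) 0 j)).

Definition spectral_norm (R : realType) (n m : nat) (K : 'M[R[i]]_(n, m)) : R :=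
  \big[Num.max/0]_(j < m) singular_value K j.

Definition csqrt (R : realType) (x : R) : R[i] :=
  if 0 <= x then (Num.sqrt x)%:C else 'i%C * (Num.sqrt (- x))%:C.

Definition real_diag_mx (R : realType) (n : nat) (s : n.-tuple R) : 'M[R[i]]_n :=
  diag_mx (\row_(i < n) (s`_i)%:C).

Definition sqrt_diag_mx (R : realType) (n m r : nat) (eps : r.-tuple R) :
    'M[R[i]]_(n, m) :=
  \matrix_(i < n, j < m)
    if (i == j :> nat) && (i < r)%N then (Num.sqrt eps`_i)%:C else 0.

Definition alpha (R : realType) (lam mu : R) : R :=
  (lam - mu) ^+ 2 / (4 * lam ^+ 2).

Definition eta_plus (R : realType) (lam mu eps : R) : R[i] :=
  ((lam + mu) / 2)%:C + lam%:C * csqrt (alpha lam mu - eps).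

Definition eta_minus (R : realType) (lam mu eps : R) : R[i] :=
  ((lam + mu) / 2)%:C - lam%:C * csqrt (alpha lam mu - eps).

Definition jordan_chain2 (R : realType) (n : nat) (S : 'M[R[i]]_n) (eta : R[i])
    (v1 v2 : 'cV[R[i]]_n) : Prop :=
  [/\ v1 != 0, (S - eta%:M) *m v1 = 0 & (S - eta%:M) *m v2 = v1].

(* Main.v *)
Require Import Defs.
From mathcomp Require Import all_boot all_order all_algebra.
From mathcomp Require Import reals.
From mathcomp Require Import complex.
From mathcomp Require Import ring lra.

Set Implicit Arguments.
Unset Strict Implicit.
Unset Printing Implicit Defensive.

Import Order.TTheory GRing.Theory Num.Theory.
Local Open Scope complex_scope.
Local Open Scope ring_scope.
Local Open Scope sesquilinear_scope.

(** In the bases of eigenvectors of A and D everything decouples.  Conjugating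
    S by the unitary matrix diag(U, V) leaves a block matrix whose four blocks
    are (rectangular) diagonal, so that S is the direct sum of the numbers
    lambda_i and mu_i with i > r and of the 2 x 2 matrices
<<
      [ lambda_i     - lambda_i s_i ]
      [ s_i lambda_i   mu_i         ]    with s_i = sqrt(epsilon_i), i <= r.
>>
    The matrix of index i has trace lambda_i + mu_i and determinant
    lambda_i (mu_i + lambda_i epsilon_i), and its eigenvalues are the two
    numbers eta_i.  The discriminant is, up to the factor 4 lambda_i^2,
    alpha_i - epsilon_i, and the sign of the determinant is the sign of
    epsilon_i + mu_i / lambda_i; cases a) to e) are read off from these signs.

    Reordering the basis to make the 2 x 2 matrices visible is avoided by
    working with all indices at once: a matrix [rdiag_mx n m f] carries the
    values f i on its main diagonal, such matrices multiply pointwise, and an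
    identity between blocks of this shape is an identity between the i-th
    scalars.  Two unipotent changes of basis then do the work.  The lower
    triangular one, with off-diagonal block diag(y_i), where y_i solves the
    scalar Riccati equation
    y (lambda - lambda s y) = s lambda + mu y, makes the matrix block upper
    triangular with the eta_i^+ in the first and the eta_i^- in the second
    diagonal block ([block_diags_triangular]).  This gives the spectrum even
    when eigenvalues collide.  If epsilon_i <> alpha_i for all i, then
    eta_i^+ <> eta_i^-, and an upper triangular one, whose entries are the
    quotients lambda_i s_i / (eta_i^+ - eta_i^-), removes the remaining block
    ([block_diags_diagonal]).  If epsilon_i = alpha_i, then the 2 x 2 matrix
    minus its eigenvalue is a nonzero multiple of [[1, -1], [1, -1]], which is
    nilpotent ([jordan_chain_block_diags]).

    The bound on the norm of K holds because K^* K is unitarily similar to the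
    diagonal matrix of the epsilon_i, completed by zeros
    ([singular_value_rdiag]). *)

(** * Eigenvalues and diagonalizability under a change of basis *)

Lemma eigenvalue_intertwine (F : fieldType) n (S T P : 'M[F]_n) :
  P \in unitmx -> S *m P = P *m T -> eigenvalue S =1 eigenvalue T.
Proof.
have sub (S1 T1 P1 : 'M[F]_n) z : P1 \in unitmx -> S1 *m P1 = P1 *m T1 ->
    eigenvalue S1 z -> eigenvalue T1 z.
  move=> uP eSP /eigenvalueP[v vS v0]; apply/eigenvalueP; exists (v *m P1).
    by rewrite -mulmxA -eSP mulmxA vS scalemxAl.
  by rewrite mulmx_free_eq0 // row_free_unit.
move=> uP eSP z; apply/idP/idP; first exact: sub eSP.
apply: (sub _ _ (invmx P)); first by rewrite unitmx_inv.
by rewrite -[RHS](mulmxK uP) -(mulmxA _ S) eSP mulKmx.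
Qed.

Lemma diagonalizable_intertwine (F : fieldType) n (S P : 'M[F]_n) (T : 'M[F]_n) :
  P \in unitmx -> S *m P = P *m T -> is_diag_mx T -> diagonalizable S.
Proof.
move=> uP eSP dT; exists (invmx P); first by rewrite unitmx_inv.
apply/diagonalizable_forP; first by rewrite unitmx_inv.
by move=> i j ij; rewrite invmxK -mulmxA eSP mulKmx //; apply/is_diag_mxP: ij.
Qed.

Lemma char_poly_ublock (F : comNzRingType) n m (A : 'M[F]_n)
    (B : 'M[F]_(n, m)) (D : 'M[F]_m) :
  char_poly (block_mx A B 0 D) = char_poly A * char_poly D.
Proof.
rewrite /char_poly /char_poly_mx map_block_mx scalar_mx_block opp_block_mx.
by rewrite add_block_mx !map_mx0 oppr0 addr0 det_ublock.
Qed.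

(** * Rectangular diagonal matrices *)

(** The entries come from a function on all natural numbers, and not from a
    row vector, so that matrices of different formats share one index; the
    price is a vanishing condition in [mul_rdiag_mx]. *)
Definition rdiag_mx (F : nmodType) n m (f : nat -> F) : 'M[F]_(n, m) :=
  \matrix_(i, j) if i == j :> nat then f i else 0.

Section RectangularDiagonal.
Variables (F : fieldType) (n m : nat).
Implicit Types f g : nat -> F.

Lemma eq_rdiag_mx f g : (forall i, (i < n)%N -> (i < m)%N -> f i = g i) ->
  rdiag_mx n m f = rdiag_mx n m g.
Proof.
move=> efg; apply/matrixP=> i j; rewrite !mxE.
by case: eqP => // eij; apply: efg; rewrite // eij.
Qed.

(** An index i >= m lies outside the inner dimension, so that the product
    matrix has a zero at (i, i) and f i * g i must agree with it. *)
Lemma mul_rdiag_mx q f g : (forall i, (m <= i)%N -> f i * g i = 0) ->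
  rdiag_mx n m f *m rdiag_mx m q g = rdiag_mx n q (fun i => f i * g i).
Proof.
move=> fg0; apply/matrixP=> i j; rewrite !mxE.
have [im|mi] := ltnP i m; last first.
  rewrite big1 => [|l _]; first by rewrite fg0 // if_same.
  by rewrite !mxE gtn_eqF ?mul0r // (leq_trans _ mi).
rewrite (bigD1 (Ordinal im)) //= !mxE /= eqxx big1 ?addr0 => [|l lNi].
  by case: ifP => // _; rewrite mulr0.
by rewrite !mxE eq_sym -[l == i :> nat]/(l == Ordinal im) (negPf lNi) mul0r.
Qed.

Lemma add_rdiag_mx f g :
  rdiag_mx n m f + rdiag_mx n m g = rdiag_mx n m (fun i => f i + g i).
Proof. by apply/matrixP=> i j; rewrite !mxE; case: eqP => // _; rewrite addr0. Qed.

Lemma opp_rdiag_mx f : - rdiag_mx n m f = rdiag_mx n m (fun i => - f i).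
Proof. by apply/matrixP=> i j; rewrite !mxE (fun_if -%R) oppr0. Qed.

Lemma tr_rdiag_mx f : (rdiag_mx n m f)^T = rdiag_mx m n f.
Proof. by apply/matrixP=> i j; rewrite !mxE eq_sym; case: eqP => // ->. Qed.

Lemma rdiag_mx_is_diag f : is_diag_mx (rdiag_mx n m f).
Proof. by apply/is_diag_mxP=> i j /negPf ij; rewrite mxE ij. Qed.

End RectangularDiagonal.

Lemma root_char_poly_rdiag (F : fieldType) n (f : nat -> F) z :
  root (char_poly (rdiag_mx n n f)) z <-> exists2 i, (i < n)%N & z = f i.
Proof.
rewrite char_poly_trig; last exact/is_diag_mx_is_trig/rdiag_mx_is_diag.
rewrite rootE horner_prod; split=> [/prodf_eq0[i _]|[i ltin ->]].
  by rewrite /= !hornerE mxE eqxx subr_eq0 => /eqP->; exists i.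
apply/prodf_eq0; exists (Ordinal ltin) => //.
by rewrite !hornerE mxE eqxx subrr.
Qed.

Lemma mul_rdiag_delta (F : fieldType) n m (f : nat -> F) (i : 'I_n) (j : 'I_m) :
  i = j :> nat -> rdiag_mx n m f *m delta_mx j (0 : 'I_1) = f i *: delta_mx i 0.
Proof.
move=> ij; apply/matrixP=> k l; rewrite !mxE (bigD1 j) //= big1 ?addr0.
  rewrite !mxE !eqxx ord1 eqxx -ij andbT mulr1 -val_eqE /=.
  by case: eqP => [->|_]; rewrite ?mulr1 ?mulr0.
by move=> q /negPf qj; rewrite !mxE qj mulr0.
Qed.

Lemma rank_diag_mx (F : fieldType) n (d : 'rV[F]_n) :
  \rank (diag_mx d) = (\sum_(i < n) (d 0%R i != 0%R))%N.
Proof.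
elim: n d => [|n IHn] d.
  by rewrite big_ord0; apply/eqP; rewrite -leqn0 rank_leq_row.
rewrite big_ord_recl -[LHS]/(\rank (diag_mx (d : 'rV_(1 + n)))).
(* Split off the first diagonal entry. *)
rewrite -{1}(@hsubmxK _ 1 1 n d) diag_mx_row.
rewrite (rank_diag_block_mx (diag_mx _ : 'M_1)) IHn; congr (_ + _)%N.
  rewrite rank_rV; congr (nat_of_bool (~~ _)).
  apply/eqP/eqP => [/matrixP/(_ 0 0)|d0].
    by rewrite !mxE eqxx mulr1n => <-; congr (d _ _); apply/val_inj.
  apply/matrixP=> i j; rewrite !ord1 !mxE eqxx mulr1n -[RHS]d0.
  by congr (d _ _); apply/val_inj.
apply: eq_bigr => i _; rewrite mxE; congr (nat_of_bool (d _ _ != 0)).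
exact/val_inj.
Qed.

(** * The block matrix with rectangular diagonal blocks *)

Section BlockOfDiagonals.
Variables (F : fieldType) (n m : nat).

Lemma unit_lblock1 (Y : 'M[F]_(m, n)) : block_mx 1%:M 0 Y 1%:M \in unitmx.
Proof. by rewrite unitmxE det_lblock !det1 mulr1 unitr1. Qed.

Lemma unit_ublock1 (X : 'M[F]_(n, m)) : block_mx 1%:M X 0 1%:M \in unitmx.
Proof. by rewrite unitmxE det_ublock !det1 mulr1 unitr1. Qed.

Definition block_diags (l d s : nat -> F) : 'M[F]_(n + m) :=
  block_mx (rdiag_mx n n l) (rdiag_mx n m (fun i => - (l i * s i)))
           (rdiag_mx m n (fun i => s i * l i)) (rdiag_mx m m d).

(** The Riccati equation says that (1, y_i) spans an invariant line of the
    i-th 2 x 2 matrix.  At the indices beyond n or m only one of the two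
    coordinates exists, and the coupling s_i and y_i are zero there. *)
Lemma block_diags_triangularize (l d s y : nat -> F) :
    (forall i, (n <= i)%N || (m <= i)%N -> s i = 0 /\ y i = 0) ->
    (forall i, y i * (l i - l i * s i * y i) = s i * l i + d i * y i) ->
  block_diags l d s *m block_mx 1%:M 0 (rdiag_mx m n y) 1%:M =
  block_mx 1%:M 0 (rdiag_mx m n y) 1%:M *m
    block_mx (rdiag_mx n n (fun i => l i - l i * s i * y i))
             (rdiag_mx n m (fun i => - (l i * s i)))
             0 (rdiag_mx m m (fun i => d i + l i * s i * y i)).
Proof.
move=> sy0 ric; rewrite !mulmx_block.
rewrite !(mulmx0, mul0mx, mulmx1, mul1mx, add0r, addr0).
rewrite !mul_rdiag_mx => [|i ni|i ni|i ni|i ni].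
  2-5: by have [|s0 y0] := sy0 i;
    rewrite ?ni ?orbT // ?s0 ?y0 ?(mulr0, mul0r, oppr0).
rewrite !add_rdiag_mx; congr block_mx; apply: eq_rdiag_mx => i _ _.
- ring.
- by rewrite ric.
- ring.
Qed.

(** The second hypothesis is the Sylvester equation X B - A X = C for the block
    X that splits a block triangular matrix, written entrywise. *)
Lemma triangular_block_diagonalize (a b c x : nat -> F) :
    (forall i, (n <= i)%N || (m <= i)%N -> x i = 0) ->
    (forall i, x i * (b i - a i) = c i) ->
  block_mx (rdiag_mx n n a) (rdiag_mx n m c) 0 (rdiag_mx m m b) *m
    block_mx 1%:M (rdiag_mx n m x) 0 1%:M =
  block_mx 1%:M (rdiag_mx n m x) 0 1%:M *m
    block_mx (rdiag_mx n n a) 0 0 (rdiag_mx m m b).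
Proof.
move=> x0 xc; rewrite !mulmx_block.
rewrite !(mulmx0, mul0mx, mulmx1, mul1mx, add0r, addr0).
rewrite !mul_rdiag_mx => [|i mi|i ni]; rewrite ?x0 ?mi ?ni ?orbT ?mulr0 ?mul0r //.
rewrite add_rdiag_mx; congr block_mx; apply: eq_rdiag_mx => i _ _.
by rewrite -xc; ring.
Qed.

End BlockOfDiagonals.

(** * The scalar formulas *)

Section Scalars.
Variable R : realType.
Implicit Types lam mu eps x : R.

Lemma csqrt_ge0 x : 0 <= x -> csqrt x = (Num.sqrt x)%:C.
Proof. by rewrite /csqrt => ->. Qed.

Lemma csqrt_lt0 x : x < 0 -> csqrt x = 'i%C * (Num.sqrt (- x))%:C.
Proof. by move=> x0; rewrite /csqrt leNgt x0. Qed.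

Lemma sqr_csqrt x : csqrt x ^+ 2 = x%:C.
Proof.
have [x0|x0] := leP 0 x; first by rewrite csqrt_ge0 // -rmorphXn sqr_sqrtr.
rewrite csqrt_lt0 // exprMn sqr_i -rmorphXn sqr_sqrtr ?oppr_ge0 ?ltW //.
by rewrite mulN1r -rmorphN opprK.
Qed.

Lemma eta_plusD_minus lam mu eps :
  eta_plus lam mu eps + eta_minus lam mu eps = lam%:C + mu%:C.
Proof.
rewrite /eta_plus /eta_minus addrACA subrr addr0 -!rmorphD; congr _%:C.
by field.
Qed.

Lemma eta_plusB_minus lam mu eps :
  eta_plus lam mu eps - eta_minus lam mu eps
    = (2 * lam)%:C * csqrt (alpha lam mu - eps).
Proof. by rewrite /eta_plus /eta_minus [(2 * lam)%:C]rmorphM rmorph_nat; ring. Qed.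

(** The characteristic equation of the 2 x 2 matrix: eta is a root of
    (lam - z) (mu - z) + lam^2 eps, by the choice of alpha. *)
Lemma eta_plus_quadratic lam mu eps : lam != 0 ->
  (lam%:C - eta_plus lam mu eps) * (eta_plus lam mu eps - mu%:C)
    = (lam ^+ 2 * eps)%:C.
Proof.
move=> lam0; rewrite /eta_plus; set q := csqrt _.
have -> : lam%:C - (((lam + mu) / 2)%:C + lam%:C * q)
    = ((lam - mu) / 2)%:C - lam%:C * q.
  by rewrite opprD addrA -rmorphB; congr (_%:C - _); field.
have -> : ((lam + mu) / 2)%:C + lam%:C * q - mu%:C
    = ((lam - mu) / 2)%:C + lam%:C * q.
  by rewrite addrAC -rmorphB; congr (_%:C + _); field.
rewrite -subr_sqr exprMn sqr_csqrt -!rmorphXn -rmorphM -rmorphB.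
by congr _%:C; rewrite /alpha; field.
Qed.

(** For eps = 0 the discriminant is a square; lam >= mu decides which root is
    which. *)
Lemma eta_eps0 lam mu : 0 < lam -> mu <= 0 ->
  eta_plus lam mu 0 = lam%:C /\ eta_minus lam mu 0 = mu%:C.
Proof.
move=> lam0 mu0; have q : csqrt (alpha lam mu - 0) = ((lam - mu) / (2 * lam))%:C.
  have -> : alpha lam mu - 0 = ((lam - mu) / (2 * lam)) ^+ 2.
    by rewrite /alpha; field; rewrite gt_eqF.
  rewrite csqrt_ge0 ?sqr_ge0 // sqrtr_sqr ger0_norm // divr_ge0 //; lra.
rewrite /eta_plus /eta_minus q -rmorphM -rmorphD -rmorphB.
by split; congr _%:C; field; rewrite gt_eqF.
Qed.

(** Half of the distance between the eigenvalues, once these are real. *)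
Definition half_gap lam mu eps := lam * Num.sqrt (alpha lam mu - eps).

Lemma eta_real lam mu eps : eps <= alpha lam mu ->
  eta_plus lam mu eps = ((lam + mu) / 2 + half_gap lam mu eps)%:C /\
  eta_minus lam mu eps = ((lam + mu) / 2 - half_gap lam mu eps)%:C.
Proof.
move=> le; rewrite /eta_plus /eta_minus csqrt_ge0 ?subr_ge0 //.
by rewrite -rmorphM -rmorphD -rmorphB.
Qed.

Lemma half_gap_sqr lam mu eps : lam != 0 -> eps <= alpha lam mu ->
  half_gap lam mu eps ^+ 2 = ((lam - mu) / 2) ^+ 2 - lam ^+ 2 * eps.
Proof.
move=> lam0 le; rewrite /half_gap exprMn sqr_sqrtr ?subr_ge0 // /alpha.
by field.
Qed.

Lemma half_gap_ge0 lam mu eps : 0 < lam -> 0 <= half_gap lam mu eps.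
Proof. by move=> lam0; rewrite mulr_ge0 ?sqrtr_ge0 // ltW. Qed.

(** The determinant lam (mu + lam eps) is negative, hence half_gap exceeds
    |(lam + mu) / 2|; as eps > 0, it is less than (lam - mu) / 2. *)
Lemma eta_opposite_signs lam mu eps : 0 < lam -> 0 < eps < - mu / lam ->
  [/\ eta_plus lam mu eps < lam%:C, 0 < eta_plus lam mu eps,
      eta_minus lam mu eps < 0 & mu%:C < eta_minus lam mu eps].
Proof.
move=> lam0 /andP[eps0]; rewrite ltr_pdivlMr // => epslt.
have le : eps <= alpha lam mu.
  rewrite /alpha ler_pdivlMr ?mulr_gt0 ?exprn_gt0 //.
  (* alpha + mu / lam = (lam + mu)^2 / (4 lam^2) *)
  have: 0 <= (lam + mu) ^+ 2 by exact: sqr_ge0.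
  nra.
have [-> ->] := eta_real le; rewrite !ltcE /= !eqxx /=.
have := half_gap_sqr (lt0r_neq0 lam0) le; have := @half_gap_ge0 lam mu eps lam0.
set h := half_gap _ _ _ => h0 h2.
have le0 : 0 < lam * (lam * eps) by rewrite !mulr_gt0.
have ltlm : lam * (lam * eps) < lam * - mu by rewrite ltr_pM2l // mulrC.
have mu0 : mu < 0 by have := mulr_gt0 lam0 eps0; lra.
have lt : h < (lam - mu) / 2.
  rewrite -(ltr_pXn2r (isT : (0 < 2)%N)) ?nnegrE ?h2 //; last by lra.
  by rewrite expr2 -mulrA; lra.
have gt : `|(lam + mu) / 2| < h.
  rewrite -(ltr_pXn2r (isT : (0 < 2)%N)) ?nnegrE ?normr_ge0 //.
  by rewrite real_normK ?num_real // h2; lra.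
by move: gt; rewrite ltr_norml => /andP[? ?]; split; lra.
Qed.

(** The determinant is nonnegative, hence half_gap is at most
    |(lam + mu) / 2|, so that both roots lie between 0 and their sum. *)
Lemma eta_same_sign lam mu eps : 0 < lam -> - mu / lam <= eps < alpha lam mu ->
  [/\ eta_plus lam mu eps <= (Num.max (lam + mu) 0)%:C,
      eta_minus lam mu eps < eta_plus lam mu eps &
      (Num.min (lam + mu) 0)%:C <= eta_minus lam mu eps].
Proof.
move=> lam0 /andP[]; rewrite ler_pdivrMr // => epsge lt.
have [-> ->] := eta_real (ltW lt); rewrite !lecR ltcR.
have := half_gap_sqr (lt0r_neq0 lam0) (ltW lt).
have h0 : 0 < half_gap lam mu eps by rewrite mulr_gt0 // sqrtr_gt0 subr_gt0.
move: h0; set h := half_gap _ _ _ => h0 h2.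
have: h <= `|(lam + mu) / 2|.
  rewrite -(ler_pXn2r (isT : (0 < 2)%N)) ?nnegrE ?normr_ge0 ?(ltW h0) //.
  rewrite real_normK ?num_real // h2.
  have : lam * - mu <= lam * (lam * eps) by rewrite ler_pM2l // mulrC.
  lra.
rewrite le_max ge_min.
case: (leP 0 ((lam + mu) / 2)) => [s0|s0].
  rewrite ger0_norm // => ?; split; first by apply/orP; left; lra.
    by lra.
  by apply/orP; right; lra.
rewrite ltr0_norm // => ?; split; first by apply/orP; right; lra.
  by lra.
by apply/orP; left; lra.
Qed.

Lemma eta_nonreal lam mu eps : 0 < lam -> alpha lam mu < eps ->
  eta_plus lam mu eps = (eta_minus lam mu eps)^* /\
  eta_plus lam mu eps \isn't Num.real.
Proof.
move=> lam0 lt; set h := lam * Num.sqrt (- (alpha lam mu - eps)).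
have h0 : 0 < h by rewrite mulr_gt0 // sqrtr_gt0 oppr_gt0 subr_lt0.
have [-> ->] : eta_plus lam mu eps = ((lam + mu) / 2) +i* h /\
    eta_minus lam mu eps = ((lam + mu) / 2) -i* h.
  rewrite /eta_plus /eta_minus csqrt_lt0 ?subr_lt0 //.
  by rewrite -!complexr0; split; simpc; rewrite /h opprB.
split; first by rewrite -[RHS]/(conjc (_ -i* _)) /= opprK.
by rewrite realE !lecE /= (gt_eqF h0) (lt_eqF h0).
Qed.

Lemma eta_double lam mu :
  eta_plus lam mu (alpha lam mu) = ((lam + mu) / 2)%:C /\
  eta_minus lam mu (alpha lam mu) = ((lam + mu) / 2)%:C.
Proof.
by rewrite /eta_plus /eta_minus subrr csqrt_ge0 // sqrtr0 mulr0 addr0 subr0.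
Qed.

End Scalars.

(** * The scalar Riccati equation *)

Section Riccati.
Variables (R : realType) (lam mu eps : R).
Hypotheses (lam_gt0 : 0 < lam) (mu_le0 : mu <= 0) (eps_ge0 : 0 <= eps).
Let s : R[i] := (Num.sqrt eps)%:C.

(** The number y for which (1, y) is an eigenvector of
    [[lam, - lam s], [s lam, mu]] for eta_plus.  For s = 0 the convention
    x / 0 = 0 gives y = 0, which is the right value, as then eta_plus = lam. *)
Definition riccati_root : R[i] := (lam%:C - eta_plus lam mu eps) / (lam%:C * s).

Lemma lamC_neq0 : lam%:C != 0 :> R[i].
Proof. by rewrite fmorph_eq0 gt_eqF. Qed.

Lemma riccati_root_plus : lam%:C - lam%:C * s * riccati_root = eta_plus lam mu eps.
Proof.
have [e0|eN0] := eqVneq eps 0.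
  have [ep _] := eta_eps0 lam_gt0 mu_le0.
  by rewrite /s e0 sqrtr0 mulr0 mul0r subr0 ep.
have sN0 : s != 0 by rewrite fmorph_eq0 sqrtr_eq0 -ltNge lt_def eN0.
rewrite /riccati_root mulrC divfK ?subKr //.
by rewrite mulf_neq0 ?lamC_neq0.
Qed.

(** The trace leaves eta_minus for the other diagonal entry. *)
Lemma riccati_root_minus : mu%:C + lam%:C * s * riccati_root = eta_minus lam mu eps.
Proof.
apply: (addrI (eta_plus lam mu eps)); rewrite eta_plusD_minus.
by rewrite -riccati_root_plus addrCA subrK addrC.
Qed.

(** After multiplication by lam s, this is [eta_plus_quadratic]. *)
Lemma riccati_rootP :
  riccati_root * (lam%:C - lam%:C * s * riccati_root)
    = s * lam%:C + mu%:C * riccati_root.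
Proof.
rewrite riccati_root_plus; have [e0|eN0] := eqVneq eps 0.
  by rewrite /riccati_root /s e0 sqrtr0 !mulr0 invr0 mulr0 !mul0r mulr0 addr0.
have sN0 : s != 0 by rewrite fmorph_eq0 sqrtr_eq0 -ltNge lt_def eN0.
have lsN0 : lam%:C * s != 0 by rewrite mulf_neq0 ?lamC_neq0.
apply/eqP; rewrite -subr_eq [mu%:C * _]mulrC -mulrBr; apply/eqP.
rewrite /riccati_root mulrAC eta_plus_quadratic ?gt_eqF //.
apply: (mulIf lsN0); rewrite divfK // rmorphM rmorphXn -[in LHS](sqr_sqrtr eps_ge0).
by rewrite rmorphXn -/s; ring.
Qed.

End Riccati.

(** * Spectrum, diagonalizability and Jordan chains of the block matrix *)

Section BlockSpectrum.
Variables (R : realType) (n m r : nat) (lam mu eps : nat -> R).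
Hypotheses (le_rn : (r <= n)%N) (le_rm : (r <= m)%N).
Hypothesis lam_gt0 : forall i, (i < r)%N -> 0 < lam i.
Hypothesis mu_le0 : forall i, (i < r)%N -> mu i <= 0.
Hypothesis eps_ge0 : forall i, (i < r)%N -> 0 <= eps i.
Hypothesis eps_out : forall i, (r <= i)%N -> eps i = 0.

Let l i : R[i] := (lam i)%:C.
Let d i : R[i] := (mu i)%:C.
Let s i : R[i] := (Num.sqrt (eps i))%:C.
Let a i := if (i < r)%N then eta_plus (lam i) (mu i) (eps i) else l i.
Let b i := if (i < r)%N then eta_minus (lam i) (mu i) (eps i) else d i.
Let M := block_diags n m l d s.

Let s_out i : (r <= i)%N -> s i = 0.
Proof. by move=> ri; rewrite /s eps_out // sqrtr0. Qed.

Lemma le_r_out i : (n <= i)%N || (m <= i)%N -> (r <= i)%N.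
Proof. by case/orP; apply: leq_trans. Qed.

Lemma block_diags_triangular : exists2 P, P \in unitmx &
  M *m P = P *m block_mx (rdiag_mx n n a) (rdiag_mx n m (fun i => - (l i * s i)))
                         0 (rdiag_mx m m b).
Proof.
pose y i := if (i < r)%N then riccati_root (lam i) (mu i) (eps i) else 0.
exists (block_mx 1%:M 0 (rdiag_mx m n y) 1%:M); first exact: unit_lblock1.
rewrite block_diags_triangularize.
- congr (_ *m block_mx _ _ _ _); apply: eq_rdiag_mx => i _ _; rewrite /a /b /y.
    case: ltnP => ri; last by rewrite mulr0 subr0.
    exact: riccati_root_plus (lam_gt0 ri) (mu_le0 ri) (eps_ge0 ri).
  case: ltnP => ri; last by rewrite mulr0 addr0.
  exact: riccati_root_minus (lam_gt0 ri) (mu_le0 ri) (eps_ge0 ri).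
- by move=> i /le_r_out ri; rewrite s_out // /y ltnNge ri.
- move=> i; rewrite /y; case: ltnP => ri; last by rewrite s_out ?(mul0r, mulr0, addr0).
  exact: riccati_rootP (lam_gt0 ri) (mu_le0 ri) (eps_ge0 ri).
Qed.

Lemma eigenvalue_block_diags z : eigenvalue M z <->
  [\/ exists2 i, (r <= i < n)%N & z = l i,
      exists2 j, (r <= j < m)%N & z = d j,
      exists2 i, (i < r)%N & z = eta_plus (lam i) (mu i) (eps i) |
      exists2 i, (i < r)%N & z = eta_minus (lam i) (mu i) (eps i)].
Proof.
have [P uP MP] := block_diags_triangular.
rewrite (eigenvalue_intertwine uP MP) eigenvalue_root_char char_poly_ublock rootM.
split=> [/orP[]/root_char_poly_rdiag[i lti ->]|].
- rewrite /a; case: (ltnP i r) => ri; first by constructor 3; exists i.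
  by constructor 1; exists i; rewrite ?ri.
- rewrite /b; case: (ltnP i r) => ri; first by constructor 4; exists i.
  by constructor 2; exists i; rewrite ?ri.
case=> -[i ri ->]; apply/orP; [left|right|left|right];
  apply/root_char_poly_rdiag; exists i; rewrite /a /b.
- by case/andP: ri.
- by case/andP: ri => ri _; rewrite ltnNge ri.
- by case/andP: ri.
- by case/andP: ri => ri _; rewrite ltnNge ri.
- exact: leq_trans ri le_rn.
- by rewrite ri.
- exact: leq_trans ri le_rm.
- by rewrite ri.
Qed.

Lemma block_diags_diagonal :
    (forall i, (i < r)%N -> eps i != alpha (lam i) (mu i)) ->
  exists2 P, P \in unitmx &
    M *m P = P *m block_mx (rdiag_mx n n a) 0 0 (rdiag_mx m m b).
Proof.
move=> neq; have [P uP MP] := block_diags_triangular.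
pose x i := if (i < r)%N then l i * s i / (a i - b i) else 0.
exists (P *m block_mx 1%:M (rdiag_mx n m x) 0 1%:M).
  by rewrite unitmx_mul uP unit_ublock1.
rewrite mulmxA MP -!mulmxA triangular_block_diagonalize // => i.
  by move/le_r_out; rewrite /x ltnNge => ->.
rewrite /x; case: ltnP => ri; last by rewrite s_out // mulr0 mul0r oppr0.
rewrite -[b i - a i]opprB mulrN divfK // /a /b ri eta_plusB_minus mulf_neq0 //.
  by rewrite fmorph_eq0 mulf_neq0 ?gt_eqF ?lam_gt0.
apply/eqP=> /(congr1 (fun z => z ^+ 2))/eqP.
by rewrite sqr_csqrt expr0n fmorph_eq0 subr_eq0 eq_sym (negPf (neq _ ri)).
Qed.

(** With h = (lam - mu) / 2, the 2 x 2 matrix minus its double eigenvalue is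
    [[h, -h], [h, -h]]; it maps (1, 0) to (h, h) and (h, h) to 0. *)
Lemma jordan_chain_block_diags i : (i < r)%N -> eps i = alpha (lam i) (mu i) ->
  exists v1 v2, jordan_chain2 M (eta_plus (lam i) (mu i) (eps i)) v1 v2.
Proof.
move=> ri ei; have lti := leq_trans ri le_rn; have ltj := leq_trans ri le_rm.
pose i1 := Ordinal lti; pose i2 := Ordinal ltj.
have li0 := lam_gt0 ri; have mi0 := mu_le0 ri.
pose h : R[i] := ((lam i - mu i) / 2)%:C.
pose w (u v : R[i]) : 'cV_(n + m) :=
  col_mx (u *: delta_mx i1 0) (v *: delta_mx i2 0).
have lE : l i = eta_plus (lam i) (mu i) (eps i) + h.
  by rewrite ei (eta_double _ _).1 /l -rmorphD; congr _%:C; field.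
have dE : d i = eta_plus (lam i) (mu i) (eps i) - h.
  by rewrite ei (eta_double _ _).1 /d -rmorphB; congr _%:C; field.
have lsE : l i * s i = h.
  rewrite /l /s ei -rmorphM; congr _%:C.
  have -> : alpha (lam i) (mu i) = ((lam i - mu i) / (2 * lam i)) ^+ 2.
    by rewrite /alpha; field; rewrite gt_eqF.
  rewrite sqrtr_sqr ger0_norm; last by rewrite divr_ge0 //; lra.
  by field; rewrite gt_eqF.
have act u v : (M - (eta_plus (lam i) (mu i) (eps i))%:M) *m w u v =
    w (h * (u - v)) (h * (u - v)).
  rewrite mulmxBl mul_scalar_mx /M /block_diags /w mul_block_col scale_col_mx.
  rewrite opp_col_mx add_col_mx -!scalemxAr.
  rewrite (@mul_rdiag_delta _ _ _ _ i1 i1) // (@mul_rdiag_delta _ _ _ _ i1 i2) //.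
  rewrite (@mul_rdiag_delta _ _ _ _ i2 i1) // (@mul_rdiag_delta _ _ _ _ i2 i2) //.
  rewrite !scalerA -!scalerDl -!scalerBl /= [s i * _]mulrC lsE.
  by congr (col_mx (_ *: _) (_ *: _)); rewrite ?lE ?dE; ring.
have hN0 : h != 0 by rewrite fmorph_eq0 gt_eqF //; lra.
exists (w h h), (w 1 0); split.
- apply/eqP=> /matrixP/(_ (lshift m i1) 0); rewrite col_mxEu !mxE !eqxx mulr1.
  exact/eqP.
- by rewrite act subrr mulr0 /w !scale0r col_mx0.
- by rewrite act subr0 mulr1.
Qed.

End BlockSpectrum.

(** * Unitary changes of basis *)

Lemma jordan_chain2_intertwine (R : realType) n (S T P : 'M[R[i]]_n) eta v1 v2 :
  P \in unitmx -> S *m P = P *m T ->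
  jordan_chain2 T eta v1 v2 -> jordan_chain2 S eta (P *m v1) (P *m v2).
Proof.
move=> uP eSP [v1N0 Tv1 Tv2].
have eSPe (v : 'cV_n) :
    (S - eta%:M) *m (P *m v) = P *m ((T - eta%:M) *m v).
  by rewrite !mulmxA mulmxBl mulmxBr eSP scalar_mxC.
split; first last.
- by rewrite eSPe Tv2.
- by rewrite eSPe Tv1 mulmx0.
by apply: contra v1N0 => /eqP/(congr1 (mulmx (invmx P))); rewrite mulKmx // mulmx0 => ->.
Qed.

Lemma mulmx_unitaryCl (C : numClosedFieldType) n q (U : 'M[C]_n) (B : 'M_(n, q)) :
  U \is unitarymx -> U ^t* *m (U *m B) = B.
Proof. by move=> uU; rewrite -invmx_unitary // mulKmx // unitarymx_unit. Qed.

Lemma conjC_real_complex (R : realType) (x : R) : (x%:C)^* = x%:C.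
Proof. by rewrite -[LHS]/(conjc _) conjc_real. Qed.

Lemma trmxC_rdiag_real (R : realType) n m (f : nat -> R) :
  (rdiag_mx n m (fun i => (f i)%:C)) ^t* = rdiag_mx m n (fun i => (f i)%:C).
Proof.
rewrite tr_rdiag_mx; apply/matrixP=> i j; rewrite !mxE.
by case: eqP => _; rewrite ?conjC_real_complex // conjC0.
Qed.

Lemma normalmx_gram (C : numClosedFieldType) n m (K : 'M[C]_(n, m)) :
  K ^t* *m K \is normalmx.
Proof. by apply/normalmxP; rewrite trmx_mul map_mxM trmxCK. Qed.

(** The entries of spectral_diag (K^* K) come in no specified order, but each
    of them is an eigenvalue of K^* K, which V turns into the diagonal matrix of
    the squares (s i)^2. *)
Lemma singular_value_rdiag (R : realType) n m (U : 'M[R[i]]_n) (V : 'M[R[i]]_m)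
    (s : nat -> R) (j : 'I_m) :
  U \is unitarymx -> V \is unitarymx ->
  (forall i, 0 <= s i) -> (forall i, (n <= i)%N -> s i = 0) ->
  exists i, singular_value (U *m rdiag_mx n m (fun i => (s i)%:C) *m V ^t*) j = s i.
Proof.
move=> uU uV s0 sn; set K := _ *m _; set G := K ^t* *m K.
have GE : G *m V = V *m rdiag_mx m m (fun i => (s i)%:C * (s i)%:C).
  rewrite /G /K !trmx_mul !map_mxM trmxCK trmxC_rdiag_real -!mulmxA.
  rewrite mulmx_unitaryCl // -(invmx_unitary uV) mulVmx ?unitarymx_unit // mulmx1.
  by rewrite mul_rdiag_mx // => i /sn ->; rewrite rmorph0 mul0r.
have nG : G \is normalmx := normalmx_gram K.
have : eigenvalue G (spectral_diag G 0 j).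
  have uQ := spectral_unit G; set Q := spectralmx G in uQ.
  have eQ : G *m invmx Q = invmx Q *m diag_mx (spectral_diag G).
    by rewrite [in LHS](orthomx_spectralP nG) -/Q mulmxK.
  rewrite (eigenvalue_intertwine _ eQ) ?unitmx_inv // eigenvalue_root_char.
  rewrite char_poly_trig; last exact: diag_mx_is_trig.
  rewrite rootE horner_prod; apply/prodf_eq0; exists j => //.
  by rewrite !hornerE !mxE eqxx subrr.
rewrite (eigenvalue_intertwine (unitarymx_unit uV) GE) eigenvalue_root_char.
move/root_char_poly_rdiag=> [i _ Gj]; exists i.
by rewrite /singular_value -/G Gj -rmorphM /= -expr2 sqrtr_sqr ger0_norm.
Qed.

Lemma real_diag_mxE (R : realType) n (t : n.-tuple R) :
  real_diag_mx t = rdiag_mx n n (fun i => (t`_i)%:C).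
Proof. by apply/matrixP=> i j; rewrite !mxE -val_eqE; case: eqP. Qed.

Lemma sqrt_diag_mxE (R : realType) n m r (t : r.-tuple R) :
  sqrt_diag_mx n m t = rdiag_mx n m (fun i => (Num.sqrt t`_i)%:C).
Proof.
apply/matrixP=> i j; rewrite !mxE; case: ltnP => ri; rewrite ?andbT ?andbF //.
by rewrite nth_default ?size_tuple // sqrtr0 if_same.
Qed.

(** This turns dim ker D into the position at which the zero eigenvalues
    start in the sorted sequence mu. *)
Lemma count_lt0_real_diag (R : realType) m (mu : m.-tuple R) (V : 'M[R[i]]_m) :
  V \in unitmx ->
  count (fun x => x < 0) mu =
  (count (fun x => x <= 0)%R mu
    - \rank (kermx (V *m real_diag_mx mu *m invmx V)^T))%N.
Proof.
move=> uV; rewrite mxrank_ker mxrank_tr mxrankMfree ?row_free_unit ?unitmx_inv //.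
rewrite eqmxMfull ?row_full_unit // rank_diag_mx.
set rk := (\sum_(i < m) _)%N.
have {rk}-> : rk = count (fun x => x != 0) mu.
  rewrite -sum1_count big_tuple big_mkcond; apply: eq_bigr => i _.
  by rewrite mxE fmorph_eq0 -(tnth_nth 0); case: eqP.
rewrite -[X in (X - count _ _)%N](size_tuple mu) -(count_predC (fun x => x != 0)).
rewrite addKn; suff -> : count (fun x => x <= 0) mu =
    addn (count (fun x => x < 0) mu) (count (predC (fun x => x != 0)) mu).
  by rewrite addnK.
elim: (tval mu) => //= x t ->; rewrite addnACA; congr (_ + _)%N.
by case: ltgtP.
Qed.

(** * The theorem *)

Theorem theorem4p4 (R : realType) (n m k r p : nat)
  (A : 'M[R[i]]_n) (D : 'M[R[i]]_m)
  (lam : n.-tuple R) (mu : m.-tuple R) (kappa : R) (eps : r.-tuple R)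
  (U : 'M[R[i]]_n) (V : 'M[R[i]]_m)
  (hA : A \is hermsymmx) (hD : D \is hermsymmx)
  (lam_eig : char_poly A = \prod_(l <- lam) ('X - (l%:C)%:P))
  (lam_sorted : sorted >=%R lam)
  (hk : k = count (fun l => 0 < l) lam)
  (mu_eig : char_poly D = \prod_(l <- mu) ('X - (l%:C)%:P))
  (mu_sorted : sorted <=%R mu)
  (hr : r = count (fun l => l <= 0) mu)
  (* kermx is a row kernel: the transpose yields {x | D x = 0} *)
  (hp : p = \rank (kermx D^T))
  (kappa_gt0 : 0 < kappa)
  (le_rk : (r <= k)%N)
  (hkappa : forall i, (i < r - p)%N -> 0 < kappa ^+ 2 * lam`_i + mu`_i)
  (heps_neg : forall i, (i < r - p)%N ->
     [/\ 0 < eps`_i, eps`_i < kappa ^+ 2 & 0 < eps`_i * lam`_i + mu`_i])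
  (heps_zero : forall j, (r - p <= j < r)%N -> 0 <= eps`_j < kappa ^+ 2)
  (hU : U \is unitarymx) (hV : V \is unitarymx)
  (hAU : A = U *m real_diag_mx lam *m U ^t*)
  (hDV : D = V *m real_diag_mx mu *m V ^t*) :
  let K : 'M[R[i]]_(n, m) := U *m sqrt_diag_mx n m eps *m V ^t* in
  let S : 'M[R[i]]_(n + m) := block_mx A (- (A *m K)) (K ^t* *m A) D in
  let al i := alpha lam`_i mu`_i in
  let etap i := eta_plus lam`_i mu`_i eps`_i in
  let etam i := eta_minus lam`_i mu`_i eps`_i in
  [/\ spectral_norm K < kappa,
      forall z : R[i], eigenvalue S z <->
        [\/ exists2 i, (r <= i < n)%N & z = (lam`_i)%:C,
            exists2 j, (r <= j < m)%N & z = (mu`_j)%:C,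
            exists2 i, (i < r)%N & z = etap i |
            exists2 i, (i < r)%N & z = etam i],
      forall i, (i < r)%N ->
        [/\ 0 < eps`_i < - mu`_i / lam`_i ->
              [/\ etap i < (lam`_i)%:C, 0 < etap i,
                  etam i < 0 & (mu`_i)%:C < etam i],
            - mu`_i / lam`_i <= eps`_i < al i ->
              [/\ etap i <= (Num.max (lam`_i + mu`_i) 0)%:C,
                  etam i < etap i &
                  (Num.min (lam`_i + mu`_i) 0)%:C <= etam i],
            al i < eps`_i < kappa ^+ 2 ->
              etap i = (etam i)^* /\ etap i \isn't Num.real,
            eps`_i = al i ->
              [/\ etap i = etam i, etam i = ((lam`_i + mu`_i) / 2)%:C &
                  exists v1 v2, jordan_chain2 S (etap i) v1 v2] &
            (r - p <= i)%N -> eps`_i = 0 ->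
              [/\ etap i = (lam`_i)%:C, 0 < lam`_i,
                  etam i = (mu`_i)%:C & mu`_i = 0]] &
      (forall i, (i < r)%N -> eps`_i != al i) -> diagonalizable S].
Proof.
move=> K S al etap etam.
have n_ge_r : (r <= n)%N.
  by rewrite (leq_trans le_rk) // hk -[X in (_ <= X)%N](size_tuple lam) count_size.
have m_ge_r : (r <= m)%N by rewrite hr -[X in (_ <= X)%N](size_tuple mu) count_size.
have lam_gt0 i : (i < r)%N -> 0 < lam`_i.
  move=> ri; have ik : (i < count (fun l => 0 < l)%R lam)%N.
    by rewrite -hk (leq_trans ri).
  (* lam is increasing, and below 0 where it is positive, in the dual order *)
  exact: (@nth_count_lt _ R^d 0 0 _ _ lam_sorted ik).
have mu_le0 i : (i < r)%N -> mu`_i <= 0.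
  by rewrite hr; apply: nth_count_le.
have mu_eq0 i : (i < r)%N -> (r - p <= i)%N -> mu`_i = 0.
  move=> ri pi; apply: nth_count_eq => //; rewrite -hr ri andbT.
  rewrite (count_lt0_real_diag mu (unitarymx_unit hV)) -hr invmx_unitary //.
  by rewrite -hDV -hp.
have eps_bounds i : (i < r)%N -> 0 <= eps`_i < kappa ^+ 2.
  move=> ri; have [lt|ge] := ltnP i (r - p); last by apply: heps_zero; rewrite ge.
  by have [/ltW-> ->] := heps_neg i lt.
have eps_ge0 i : (i < r)%N -> 0 <= eps`_i by move/eps_bounds=> /andP[].
have eps_out i : (r <= i)%N -> eps`_i = 0.
  by move=> ri; rewrite nth_default ?size_tuple.
pose W : 'M[R[i]]_(n + m) := block_mx U 0 0 V.
have uW : W \in unitmx by rewrite /W unitmxE det_ublock unitrM -!unitmxE !unitarymx_unit.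
have SW : S *m W = W *m block_diags n m (fun i => (lam`_i)%:C)
    (fun i => (mu`_i)%:C) (fun i => (Num.sqrt eps`_i)%:C).
  have UU : U ^t* *m U = 1%:M.
    by rewrite -invmx_unitary // mulVmx // unitarymx_unit.
  have VV : V ^t* *m V = 1%:M.
    by rewrite -invmx_unitary // mulVmx // unitarymx_unit.
  have AU : A *m U = U *m rdiag_mx n n (fun i => (lam`_i)%:C).
    by rewrite hAU real_diag_mxE -mulmxA UU mulmx1.
  have DV : D *m V = V *m rdiag_mx m m (fun i => (mu`_i)%:C).
    by rewrite hDV real_diag_mxE -mulmxA VV mulmx1.
  have s_out i : (n <= i)%N -> (Num.sqrt eps`_i)%:C = 0 :> R[i].
    by move=> ni; rewrite eps_out ?sqrtr0 // (leq_trans n_ge_r).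
  rewrite /S /W /block_diags !mulmx_block !(mulmx0, mul0mx, addr0, add0r).
  congr block_mx => //.
    rewrite mulNmx /K sqrt_diag_mxE !mulmxA AU -!mulmxA VV mulmx1.
    by rewrite mul_rdiag_mx ?opp_rdiag_mx -?mulmxN ?opp_rdiag_mx // => i /s_out ->;
      rewrite mulr0.
  rewrite -mulmxA AU /K sqrt_diag_mxE !trmx_mul !map_mxM trmxCK trmxC_rdiag_real.
  rewrite -!mulmxA [U ^t* *m _]mulmxA UU mul1mx mul_rdiag_mx // => i /s_out ->.
  by rewrite mul0r.
split.
- rewrite /spectral_norm /K sqrt_diag_mxE; apply: bigmax_lt => // j _.
  have [||i ->] := @singular_value_rdiag R n m U V (fun i => Num.sqrt eps`_i) j hU hV.
  + by move=> i; apply: sqrtr_ge0.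
  + by move=> i ni; rewrite eps_out ?sqrtr0 // (leq_trans n_ge_r).
  have : eps`_i < kappa ^+ 2.
    have [/eps_bounds/andP[]|/eps_out ->] // := ltnP i r.
    by rewrite exprn_gt0.
  by rewrite -(ltr_sqrt _ (exprn_gt0 2 kappa_gt0)) sqrtr_sqr gtr0_norm.
- move=> z; rewrite (eigenvalue_intertwine uW SW).
  exact: (eigenvalue_block_diags n_ge_r m_ge_r lam_gt0 mu_le0 eps_ge0 eps_out).
- move=> i ri; split.
  + exact/eta_opposite_signs/lam_gt0.
  + exact/eta_same_sign/lam_gt0.
  + by case/andP=> lt _; apply: eta_nonreal => //; apply: lam_gt0.
  + move=> e; have [ep em] := eta_double lam`_i mu`_i.
    rewrite /etap /etam e ep em; split=> //.
    have [v1 [v2 chain]] := jordan_chain_block_diags n_ge_r m_ge_r lam_gt0 mu_le0 ri e.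
    exists (W *m v1), (W *m v2); apply: jordan_chain2_intertwine uW SW _.
    by move: chain; rewrite e ep.
  + move=> pi e; have mu0 := mu_eq0 i ri pi.
    have [ep em] := eta_eps0 (lam_gt0 i ri) (mu_le0 i ri).
    by rewrite /etap /etam e ep em lam_gt0.
move=> neq; have [P uP MP] :=
  block_diags_diagonal n_ge_r m_ge_r lam_gt0 mu_le0 eps_ge0 eps_out neq.
move/(congr1 (mulmx W)): MP; rewrite !mulmxA -SW -[S *m W *m P]mulmxA.
move/diagonalizable_intertwine; apply; first by rewrite unitmx_mul uW.
by rewrite is_diag_block_mx // !rdiag_mx_is_diag !eqxx.
Qed.
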